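(* Let $\boldsymbol{\theta}=(\theta_t)_{t\in\mathcal{T}}\ge 0$ satisfy $\sum_{t\in\mathcal{T}}\alpha_{it}\theta_t=1$ for all $i\in\mathcal{C}$, $\sum_{t\in\mathcal{T}_{bs}}\theta_t\le 1$ for all $b\in\mathcal{B},s\in\mathcal{S}$, and $\sum_{s\in\mathcal{S}}\sum_{t\in\mathcal{T}_{bs}}\beta_t\theta_t\le Q^B$ for all $b\in\mathcal{B}$. Then for every $s\in\mathcal{S}$, the linear program $$\mathrm{BSP}_s(\boldsymbol{\theta}):\ \min\sum_{u\in\mathcal{U}_s}c^2_u\zeta_u\ \text{ s.t. }\ \sum_{u\in\mathcal{U}_s}\gamma_{ibu}\zeta_u\ge\sum_{t\in\mathcal{T}_{bs}}\alpha_{it}\theta_t\ \ \forall i\in\mathcal{C}_s,\,b\in\mathcal{B}_s(i);\quad \zeta_u\ge 0\ \forall u\in\mathcal{U}_s,$$ and its dual $$\mathrm{DBSP}_s(\boldsymbol{\theta}):\ \max\sum_{i\in\mathcal{C}_s}\sum_{b\in\mathcal{B}_s(i)}\sum_{t\in\mathcal{T}_{bs}}\alpha_{it}\theta_t\,\omega_{ib}\ \text{ s.t. }\ \sum_{i\in\mathcal{C}_s}\sum_{b\in\mathcal{B}_s(i)}\gamma_{ibu}\omega_{ib}\le c^2_u\ \ \forall u\in\mathcal{U}_s;\quad \omega_{ib}\ge0,$$ are both feasible and their polyhedrons are bounded.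
   Context: Setting (bus–drone parcel delivery): customers $\mathcal{C}$ with demands $q_i$ and deadlines $l_i$; buses $\mathcal{B}$ with capacity $Q^B$ arriving at stop $s\in\mathcal{S}$ at time $e_{bs}$; at most $Q^S$ boxes may be unloaded from one bus at one stop, taking time $\tau^B$; at each stop $s$ a locker with a sufficient number of drones serving the reachable customers $\mathcal{C}_s\subseteq\mathcal{C}$ by single-customer round trips of duration $\delta_{si}=\tau^S+\tau_{si}+\tau^D+\tau_{is}$, each drone having total operation duration at most $\Delta$. $\mathcal{B}_s(i)=\{b\in\mathcal{B}: e_{bs}+\tau^B+\tau^S+\tau_{si}\le l_i,\ i\in\mathcal{C}_s\}$ is the set of buses that can bring customer $i$'s parcel to stop $s$ in time. An assignment $t$ is a set of customers assigned to one bus $b$ and unloaded at one stop $s$, each customer at most once, total load $\beta_t\le Q^S$; $\mathcal{T}_{bs}$ is the set of such assignments for $(b,s)$, $\mathcal{T}=\bigcup_{b,s}\mathcal{T}_{bs}$, and $\alpha_{it}\in\{0,1\}$ indicates whether customer $i$ is in assignment $t$. A flight $u$ at locker $s$ is an ordered set of round trips of one drone from $s$, each serving a pair $(i,b)$ with $i\in\mathcal{C}_s$, $b\in\mathcal{B}_s(i)$ (trip starts after the parcel's availability time $e_{bs}+\tau^B$), respecting all served customers' deadlines and total duration at most $\Delta$; $\mathcal{U}_s$ is the set of feasible flights at $s$, $\gamma_{ibu}\in\{0,1\}$ indicates whether flight $u$ serves customer $i$ unloaded by bus $b$, and $c^2_u\ge 0$ is the flight cost (drone fixed cost plus holding cost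 of the served freight). Standing assumptions: there are sufficiently many drones, and for every $i\in\mathcal{C}_s$ and $b\in\mathcal{B}_s(i)$ the flight consisting of the single round trip serving $(i,b)$ is feasible.
   Formalization: The polyhedron of BSP_s is never bounded as a set when U_s is nonempty (any ζ_u may be increased), so for BSP_s ''bounded'' is read as: the objective is bounded below; for DBSP_s both the objective and the polyhedron itself are shown bounded. *)

(* Defs.v *)
From HB Require Import structures.
From mathcomp Require Import all_boot all_order all_algebra.
From mathcomp Require Import boolp reals.

Set Implicit Arguments.
Unset Strict Implicit.
Unset Printing Implicit Defensive.

Import Order.TTheory GRing.Theory Num.Theory.
Local Open Scope ring_scope.

(* C, B and S are the customers, the buses and the stops. *)
Record instance (R : realType) (C B S : finType) := Instance {
  demand : C -> R;             (* q_i *)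
  deadline : C -> R;           (* l_i *)
  bus_capacity : R;            (* Q^B *)
  unload_capacity : R;         (* Q^S *)
  arrival : B -> S -> R;       (* e_{bs} *)
  tauB : R;
  tauS : R;
  tauD : R;
  time_to : S -> C -> R;       (* tau_{si} *)
  time_back : C -> S -> R;     (* tau_{is} *)
  reachable : S -> {set C};    (* C_s *)
  max_duration : R             (* Delta *)
}.

(* An assignment belongs to one bus and one stop, so equal customer sets at
   different (b, s) are different columns. *)
Definition assignment (C B S : finType) : finType := (B * S * {set C})%type.

(* A flight is an ordered set of pairs (i, b).  Feasibility requires the pairs
   to be distinct, so the bound on the length excludes no feasible flight and
   makes the type finite. *)
Definition flight (C B : finType) : finType := #|{: C * B}|.-bseq (C * B)%type.

Definition trip_duration (R : realType) (C B S : finType)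
    (D : instance R C B S) (s : S) (i : C) : R :=
  tauS D + time_to D s i + tauD D + time_back D i s.

Definition in_time_buses (R : realType) (C B S : finType)
    (D : instance R C B S) (s : S) (i : C) : {set B} :=
  [set b | (i \in reachable D s) &&
           (arrival D b s + tauB D + tauS D + time_to D s i <= deadline D i)].

Definition alpha (R : realType) (C B S : finType)
    (i : C) (t : assignment C B S) : R :=
  (i \in t.2)%:R.

Definition load (R : realType) (C B S : finType)
    (D : instance R C B S) (t : assignment C B S) : R :=
  \sum_(i in t.2) demand D i.

Definition assignments_at (R : realType) (C B S : finType)
    (D : instance R C B S) (b : B) (s : S) : {set assignment C B S} :=
  [set t | [&& t.1.1 == b, t.1.2 == s & load D t <= unload_capacity D]].

Definition assignments (R : realType) (C B S : finType)
    (D : instance R C B S) : {set assignment C B S} :=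
  \bigcup_(b : B) \bigcup_(s : S) assignments_at D b s.

(* [start k] is the departure time of the k-th round trip. *)
Definition feasible_schedule (R : realType) (C B S : finType)
    (D : instance R C B S) (s : S) (u : seq (C * B)) (start : nat -> R) : Prop :=
  (forall (k : nat) (i : C) (b : B), onth u k = Some (i, b) ->
     arrival D b s + tauB D <= start k /\
     start k + tauS D + time_to D s i <= deadline D i) /\
  (forall (k : nat) (i : C) (b : B), onth u k = Some (i, b) ->
     (k.+1 < size u)%N -> start k + trip_duration D s i <= start k.+1).

Definition feasible_flight (R : realType) (C B S : finType)
    (D : instance R C B S) (s : S) (u : seq (C * B)) : Prop :=
  [/\ uniq u,
      forall (i : C) (b : B), (i, b) \in u ->
        i \in reachable D s /\ b \in in_time_buses D s i,
      exists start : nat -> R, feasible_schedule D s u start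
    & \sum_(p <- u) trip_duration D s p.1 <= max_duration D].

Definition flights_at (R : realType) (C B S : finType)
    (D : instance R C B S) (s : S) : {set flight C B} :=
  [set u : flight C B | `[< feasible_flight D s u >]].

Definition gamma (R : realType) (C B : finType)
    (i : C) (b : B) (u : flight C B) : R :=
  ((i, b) \in u)%:R.

Definition master_feasible (R : realType) (C B S : finType)
    (D : instance R C B S) (theta : assignment C B S -> R) : Prop :=
  [/\ forall t, t \in assignments D -> 0 <= theta t,
      forall i : C, \sum_(t in assignments D) alpha R i t * theta t = 1,
      forall (b : B) (s : S), \sum_(t in assignments_at D b s) theta t <= 1
    & forall b : B,
        \sum_(s : S) \sum_(t in assignments_at D b s) load D t * theta t
          <= bus_capacity D].

Definition unloaded (R : realType) (C B S : finType)
    (D : instance R C B S) (theta : assignment C B S -> R)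
    (s : S) (i : C) (b : B) : R :=
  \sum_(t in assignments_at D b s) alpha R i t * theta t.

(* In both programs a vector is a function on a larger finite type, and only
   its values on the index set of the program ([flights_at D s], respectively
   [dual_indices D s]) are meaningful. *)
Definition BSP_feasible (R : realType) (C B S : finType)
    (D : instance R C B S) (theta : assignment C B S -> R) (s : S)
    (zeta : flight C B -> R) : Prop :=
  (forall (i : C) (b : B), i \in reachable D s -> b \in in_time_buses D s i ->
     \sum_(u in flights_at D s) gamma R i b u * zeta u
       >= unloaded D theta s i b) /\
  (forall u, u \in flights_at D s -> 0 <= zeta u).

Definition BSP_objective (R : realType) (C B S : finType)
    (D : instance R C B S) (c2 : S -> flight C B -> R) (s : S)
    (zeta : flight C B -> R) : R :=
  \sum_(u in flights_at D s) c2 s u * zeta u.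

Definition dual_indices (R : realType) (C B S : finType)
    (D : instance R C B S) (s : S) : {set C * B} :=
  [set p | (p.1 \in reachable D s) && (p.2 \in in_time_buses D s p.1)].

Definition DBSP_feasible (R : realType) (C B S : finType)
    (D : instance R C B S) (c2 : S -> flight C B -> R) (s : S)
    (omega : C * B -> R) : Prop :=
  (forall u, u \in flights_at D s ->
     \sum_(i in reachable D s) \sum_(b in in_time_buses D s i)
        gamma R i b u * omega (i, b) <= c2 s u) /\
  (forall p, p \in dual_indices D s -> 0 <= omega p).

Definition DBSP_objective (R : realType) (C B S : finType)
    (D : instance R C B S) (theta : assignment C B S -> R) (s : S)
    (omega : C * B -> R) : R :=
  \sum_(i in reachable D s) \sum_(b in in_time_buses D s i)
    \sum_(t in assignments_at D b s) alpha R i t * theta t * omega (i, b).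

Definition min_bounded (R : realType) (X : Type) (P : X -> Prop) (f : X -> R)
    : Prop :=
  exists m : R, forall x, P x -> m <= f x.

Definition max_bounded (R : realType) (X : Type) (P : X -> Prop) (f : X -> R)
    : Prop :=
  exists M : R, forall x, P x -> f x <= M.

(* Boundedness in R^J, for a polyhedron whose points are given by functions on
   I that are relevant on J only. *)
Definition polyhedron_bounded (R : realType) (I : finType) (J : {set I})
    (P : (I -> R) -> Prop) : Prop :=
  exists M : R, forall x, P x -> forall j, j \in J -> `|x j| <= M.

(* Main.v *)
(* The all-ones vector is primal feasible: a customer's unloaded fraction at
   (b, s) is at most [\sum_(t in T_bs) theta_t <= 1], and the single-trip flight
   for (i, b) already covers it.  Zero is dual feasible.  Costs are nonnegative,
   so the primal objective is; the dual constraint of the single-trip flight for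
   (i, b) bounds [omega_ib] by its cost, which bounds the dual polyhedron and
   hence the dual objective. *)

Require Import Defs.
From HB Require Import structures.
From mathcomp Require Import all_boot all_order all_algebra.
From mathcomp Require Import boolp reals.

Import Order.TTheory GRing.Theory Num.Theory.
Local Open Scope ring_scope.

Section BendersSubproblem.

Variables (R : realType) (C B S : finType) (D : instance R C B S).
Variables (c2 : S -> flight C B -> R) (theta : assignment C B S -> R) (s : S).

Hypothesis c2_ge0 : forall u : flight C B, u \in flights_at D s -> 0 <= c2 s u.
Hypothesis single_trip_feasible : forall (i : C) (b : B),
  i \in reachable D s -> b \in in_time_buses D s i ->
  feasible_flight D s [:: (i, b)].
Hypothesis theta_feasible : master_feasible D theta.

(** Casts the feasible one-pair sequence into the bounded sequence type of flights; the pair itself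
    shows that [C * B] is nonempty, so length 1 is allowed. *)
Lemma single_trip_flight (i : C) (b : B) :
  i \in reachable D s -> b \in in_time_buses D s i ->
  exists2 u : flight C B, u \in flights_at D s & u = [:: (i, b)] :> seq _.
Proof.
move=> Ci Bb.
have le1 : (size [:: (i, b)] <= #|{: C * B}|)%N.
  by apply/card_gt0P; exists (i, b).
exists (Bseq le1) => //.
by rewrite inE; apply/asboolP; exact: single_trip_feasible.
Qed.

Lemma theta_ge0 (b : B) (t : assignment C B S) :
  t \in assignments_at D b s -> 0 <= theta t.
Proof.
case: theta_feasible => theta0 _ _ _ tbs; apply: theta0.
by apply/bigcupP; exists b => //; apply/bigcupP; exists s.
Qed.

Lemma unloaded_ge0 (i : C) (b : B) : 0 <= unloaded D theta s i b.
Proof.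
apply: sumr_ge0 => t /theta_ge0 theta0.
by apply: mulr_ge0 => //; exact: ler0n.
Qed.

Lemma unloaded_le1 (i : C) (b : B) : unloaded D theta s i b <= 1.
Proof.
case: theta_feasible => _ _ le1 _; apply: le_trans (le1 b s).
apply: ler_sum => t /theta_ge0 theta0.
by rewrite ler_piMl // /alpha lern1 leq_b1.
Qed.

Lemma BSP_feasible1 : BSP_feasible D theta s (fun=> 1).
Proof.
split=> [i b Ci Bb|u _]; last exact: ler01.
apply: le_trans (unloaded_le1 i b) _.
have [u Uu defu] := single_trip_flight _ _ Ci Bb.
(* The single-trip flight contributes exactly 1; the change to [bseqval u] lets [defu] rewrite the
   membership. *)
rewrite (bigD1 u) //= {1}/gamma -[_ \in u]/(_ \in bseqval u) defu mem_head mulr1.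
by rewrite lerDl; apply: sumr_ge0 => v _; rewrite mulr1 ler0n.
Qed.

Lemma DBSP_feasible0 : DBSP_feasible D c2 s (fun=> 0).
Proof.
split=> // u Uu; rewrite big1 ?c2_ge0 // => i _.
by rewrite big1 // => b _; rewrite mulr0.
Qed.

Lemma BSP_objective_ge0 (zeta : flight C B -> R) :
  BSP_feasible D theta s zeta -> 0 <= BSP_objective D c2 s zeta.
Proof.
case=> _ zeta0; apply: sumr_ge0 => u Uu.
by rewrite mulr_ge0 ?c2_ge0 ?zeta0.
Qed.

(** Summing all flight costs, rather than taking the cost of the single-trip flight alone, makes the
    bound independent of [(i, b)]. *)
Lemma DBSP_feasible_le (omega : C * B -> R) (i : C) (b : B) :
  DBSP_feasible D c2 s omega ->
  i \in reachable D s -> b \in in_time_buses D s i ->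
  omega (i, b) <= \sum_(u in flights_at D s) c2 s u.
Proof.
case=> omegac omega0 Ci Bb; have [u Uu defu] := single_trip_flight _ _ Ci Bb.
have term_ge0 j a : j \in reachable D s -> a \in in_time_buses D s j ->
    0 <= gamma R j a u * omega (j, a).
  by move=> Cj Ba; rewrite mulr_ge0 ?ler0n // omega0 // inE Cj.
rewrite (bigD1 u) //=.
have rest_ge0 : 0 <= \sum_(v in flights_at D s | v != u) c2 s v.
  by apply: sumr_ge0 => v /andP[Uv _]; exact: c2_ge0.
apply: le_trans (lerD (omegac u Uu) rest_ge0); rewrite addr0.
(* In the constraint of [u], [omega (i, b)] has coefficient 1 and all other terms are
   nonnegative. *)
rewrite (bigD1 i) //= (bigD1 b) //= {1}/gamma.
rewrite -[(i, b) \in u]/(_ \in bseqval u) defu mem_head mul1r -addrA lerDl.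
apply: addr_ge0.
  by apply: sumr_ge0 => a /andP[Ba _]; exact: term_ge0.
apply: sumr_ge0 => j /andP[Cj _].
by apply: sumr_ge0 => a Ba; exact: term_ge0.
Qed.

(** Factoring [omega (i, b)] out of the sum over assignments leaves the nonnegative weight
    [unloaded], so the bound on each coordinate carries over. *)
Lemma DBSP_objective_le (omega : C * B -> R) :
  DBSP_feasible D c2 s omega ->
  DBSP_objective D theta s omega <=
    \sum_(i in reachable D s) \sum_(b in in_time_buses D s i)
      unloaded D theta s i b * \sum_(u in flights_at D s) c2 s u.
Proof.
move=> omegaP; apply: ler_sum => i Ci; apply: ler_sum => b Bb.
by rewrite -mulr_suml ler_wpM2l ?unloaded_ge0 // DBSP_feasible_le.
Qed.

End BendersSubproblem.

(** Primal feasibility is preserved when [zeta] increases, so for the primal boundedness can only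
    concern the objective; for the dual the polyhedron itself is bounded too. *)
Theorem theorem1 (R : realType) (C B S : finType) (D : instance R C B S)
    (c2 : S -> flight C B -> R)
    (c2_ge0 : forall (s : S) (u : flight C B), u \in flights_at D s -> 0 <= c2 s u)
    (single_trip_feasible : forall (s : S) (i : C) (b : B),
       i \in reachable D s -> b \in in_time_buses D s i ->
       feasible_flight D s [:: (i, b)])
    (theta : assignment C B S -> R) (theta_feasible : master_feasible D theta)
    (s : S) :
  ((exists zeta : flight C B -> R, BSP_feasible D theta s zeta) /\
   (exists omega : C * B -> R, DBSP_feasible D c2 s omega)) /\
  (min_bounded (BSP_feasible D theta s) (BSP_objective D c2 s) /\
   max_bounded (DBSP_feasible D c2 s) (DBSP_objective D theta s) /\
   polyhedron_bounded (dual_indices D s) (DBSP_feasible D c2 s)).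
Proof.
have c0 := c2_ge0 s; have single := single_trip_feasible s.
split; split.
- by exists (fun=> 1); exact: BSP_feasible1.
- by exists (fun=> 0); exact: DBSP_feasible0.
- by exists 0 => zeta; exact: BSP_objective_ge0.
split; first by eexists => omega; exact: DBSP_objective_le.
exists (\sum_(u in flights_at D s) c2 s u) => omega omegaP [i b] Jib.
have /andP[/= Ci Bb] : (i \in reachable D s) && (b \in in_time_buses D s i).
  by move: Jib; rewrite inE.
by rewrite ger0_norm ?omegaP.2 // DBSP_feasible_le.
Qed.
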